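(* Every sequent derivable in $\boldsymbol{!}_\mathbf{b}\mathbf{L}^{\mathbf{1}}$ has a derivation in $\boldsymbol{!}_\mathbf{b}\mathbf{L}^{\mathbf{1}}$ that does not use the rule $(\mathrm{cut})$.
   Context: The calculus $\boldsymbol{!}_\mathbf{b}\mathbf{L}^{\mathbf{1}}$: formulae are built from variables $p_1,p_2,\dots$ and the constant $\mathbf{1}$ using binary $\backslash$, $/$, $\cdot$ and unary $\langle\rangle$, $[]^{-1}$, $!$. Meta-formulae are finite (possibly empty, empty one denoted $\Lambda$) sequences whose elements are formulae or bracketed meta-formulae $[\Pi]$; comma is concatenation; $\Delta(\Gamma)$ denotes $\Delta$ with a designated occurrence of a meta-formula $\Gamma$ (consecutive elements at some bracket depth). Sequents are $\Pi\to A$ ($\Pi$ meta-formula, $A$ formula). Axioms: $A\to A$, $\Lambda\to\mathbf{1}$. Rules (premises $\Rightarrow$ conclusion): $(/\to)$: $\Gamma\to B$, $\Delta(C)\to D$ $\Rightarrow$ $\Delta(C/B,\Gamma)\to D$; $(\to/)$: $\Gamma,B\to C$ $\Rightarrow$ $\Gamma\to C/B$; $(\backslash\to)$: $\Gamma\to A$, $\Delta(C)\to D$ $\Rightarrow$ $\Delta(\Gamma,A\backslash C)\to D$; $(\to\backslash)$: $A,\Gamma\to C$ $\Rightarrow$ $\Gamma\to A\backslash C$; $(\cdot\to)$: $\Delta(A,B)\to D$ $\Rightarrow$ $\Delta(A\cdot B)\to D$; $(\to\cdot)$: $\Gamma_1\to A$, $\Gamma_2\to B$ $\Rightarrow$ $\Gamma_1,\Gamma_2\to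 A\cdot B$; $(\mathbf{1}\to)$: $\Delta(\Lambda)\to A$ $\Rightarrow$ $\Delta(\mathbf{1})\to A$; $(\langle\rangle\to)$: $\Delta([A])\to C$ $\Rightarrow$ $\Delta(\langle\rangle A)\to C$; $(\to\langle\rangle)$: $\Pi\to A$ $\Rightarrow$ $[\Pi]\to\langle\rangle A$; $([]^{-1}\to)$: $\Delta(A)\to C$ $\Rightarrow$ $\Delta([[]^{-1}A])\to C$; $(\to[]^{-1})$: $[\Pi]\to A$ $\Rightarrow$ $\Pi\to[]^{-1}A$; $(!\to)$: $\Gamma(A)\to B$ $\Rightarrow$ $\Gamma(!A)\to B$; $(\to!)$: $!A_1,\dots,!A_n\to A$ $\Rightarrow$ $!A_1,\dots,!A_n\to!A$; $(\mathrm{contr}_\mathbf{b})$: $\Delta(!A_1,\dots,!A_n,[!A_1,\dots,!A_n,\Gamma])\to B$ $\Rightarrow$ $\Delta(!A_1,\dots,!A_n,\Gamma)\to B$ ($n\ge1$); $(\mathrm{perm}_1)$: $\Delta(!A,\Gamma)\to B$ $\Rightarrow$ $\Delta(\Gamma,!A)\to B$; $(\mathrm{perm}_2)$: $\Delta(\Gamma,!A)\to B$ $\Rightarrow$ $\Delta(!A,\Gamma)\to B$; $(\mathrm{cut})$: $\Pi\to A$, $\Delta(A)\to C$ $\Rightarrow$ $\Delta(\Pi)\to C$.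
   Formalization: The rule (→!) is taken with n ≥ 1, like (contr_b); if n = 0 were allowed, Λ→!1 and !1,p→⟨⟩p would give p→⟨⟩p by cut, and this sequent has no cut-free derivation. *)

(* Defs.v *)
From mathcomp Require Import all_boot.

Set Implicit Arguments.
Unset Strict Implicit.
Unset Printing Implicit Defensive.

Inductive formula : Type :=
| Var of nat
| One
| Under of formula & formula   (* [Under A C] is A \ C *)
| Over of formula & formula    (* [Over C B] is C / B *)
| Prod of formula & formula
| Diam of formula              (* <> A *)
| BoxInv of formula            (* []^{-1} A *)
| Bang of formula.

Inductive item : Type :=
| Fm of formula
| Br of seq item.

Definition metaformula : Type := seq item.

(* Meta-formulae with one hole, located between two consecutive (possibly
   absent) elements at an arbitrary bracket depth: Delta( ). *)
Inductive context : Type :=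
| Hole of metaformula & metaformula
| InBr of metaformula & context & metaformula.

Fixpoint fill (D : context) (G : metaformula) : metaformula :=
  match D with
  | Hole L R => L ++ G ++ R
  | InBr L D' R => L ++ Br (fill D' G) :: R
  end.

Definition bangs (As : seq formula) : metaformula :=
  [seq Fm (Bang A) | A <- As].

(* The list !A_1, ..., !A_n is nonempty (n >= 1) in both [BangR] and [ContrB].
   Allowing n = 0 in [BangR] would make cut non-eliminable: then Lambda -> !1,
   and from [p] -> <>p one gets !1, [!1, p] -> <>p, hence !1, p -> <>p by
   [ContrB], hence p -> <>p by cut, which has no cut-free derivation. *)
Inductive derivation : metaformula -> formula -> Type :=
| Ax (A : formula) : derivation [:: Fm A] A
| OneR : derivation [::] One
| OverL (D : context) (G : metaformula) (B C E : formula) :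
    derivation G B -> derivation (fill D [:: Fm C]) E ->
    derivation (fill D (Fm (Over C B) :: G)) E
| OverR (G : metaformula) (B C : formula) :
    derivation (G ++ [:: Fm B]) C -> derivation G (Over C B)
| UnderL (D : context) (G : metaformula) (A C E : formula) :
    derivation G A -> derivation (fill D [:: Fm C]) E ->
    derivation (fill D (G ++ [:: Fm (Under A C)])) E
| UnderR (G : metaformula) (A C : formula) :
    derivation (Fm A :: G) C -> derivation G (Under A C)
| ProdL (D : context) (A B E : formula) :
    derivation (fill D [:: Fm A; Fm B]) E ->
    derivation (fill D [:: Fm (Prod A B)]) E
| ProdR (G1 G2 : metaformula) (A B : formula) :
    derivation G1 A -> derivation G2 B -> derivation (G1 ++ G2) (Prod A B)
| OneL (D : context) (A : formula) :
    derivation (fill D [::]) A -> derivation (fill D [:: Fm One]) A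
| DiamL (D : context) (A C : formula) :
    derivation (fill D [:: Br [:: Fm A]]) C ->
    derivation (fill D [:: Fm (Diam A)]) C
| DiamR (P : metaformula) (A : formula) :
    derivation P A -> derivation [:: Br P] (Diam A)
| BoxInvL (D : context) (A C : formula) :
    derivation (fill D [:: Fm A]) C ->
    derivation (fill D [:: Br [:: Fm (BoxInv A)]]) C
| BoxInvR (P : metaformula) (A : formula) :
    derivation [:: Br P] A -> derivation P (BoxInv A)
| BangL (D : context) (A B : formula) :
    derivation (fill D [:: Fm A]) B -> derivation (fill D [:: Fm (Bang A)]) B
| BangR (As : seq formula) (A : formula) :
    0 < size As -> derivation (bangs As) A -> derivation (bangs As) (Bang A)
| ContrB (D : context) (As : seq formula) (G : metaformula) (B : formula) :
    0 < size As ->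
    derivation (fill D (bangs As ++ [:: Br (bangs As ++ G)])) B ->
    derivation (fill D (bangs As ++ G)) B
| Perm1 (D : context) (A : formula) (G : metaformula) (B : formula) :
    derivation (fill D (Fm (Bang A) :: G)) B ->
    derivation (fill D (G ++ [:: Fm (Bang A)])) B
| Perm2 (D : context) (A : formula) (G : metaformula) (B : formula) :
    derivation (fill D (G ++ [:: Fm (Bang A)])) B ->
    derivation (fill D (Fm (Bang A) :: G)) B
| Cut (D : context) (P : metaformula) (A C : formula) :
    derivation P A -> derivation (fill D [:: Fm A]) C ->
    derivation (fill D P) C.

Fixpoint cut_free (P : metaformula) (A : formula) (d : derivation P A) : bool :=
  match d with
  | Ax _ | OneR => true
  | OverL _ _ _ _ _ d1 d2 | UnderL _ _ _ _ _ d1 d2 | ProdR _ _ _ _ d1 d2 =>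
      cut_free d1 && cut_free d2
  | OverR _ _ _ d1 | UnderR _ _ _ d1 | ProdL _ _ _ _ d1 | OneL _ _ d1
  | DiamL _ _ _ d1 | DiamR _ _ d1 | BoxInvL _ _ _ d1 | BoxInvR _ _ d1
  | BangL _ _ _ d1 | BangR _ _ _ d1 | ContrB _ _ _ _ _ d1
  | Perm1 _ _ _ _ d1 | Perm2 _ _ _ _ d1 => cut_free d1
  | Cut _ _ _ _ _ _ => false
  end.

(* Main.v *)
Require Import Defs.
From mathcomp Require Import all_boot.

(** Cut is eliminated by an outer induction on the cut formula [A] and, for a
    fixed [A], two nested inductions.  The left premise is traced up through
    left rules until [A] is introduced on the right (or is an axiom).  At that
    point the whole right premise is traversed once, replacing simultaneously
    an arbitrary set of occurrences of [A] by the left antecedent [P].  Replacing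
    many occurrences at once absorbs the duplication caused by [ContrB]: when
    [A = !A'], the antecedent [P] is a nonempty list of [!]-formulae, so a list
    of [!]-formulae remains one after the replacement, and [ContrB], [BangR]
    and the permutation rules stay applicable.  Only where [A] is principal on
    the right are cuts needed, and these are on immediate subformulae of [A]. *)

Set Implicit Arguments.
Unset Strict Implicit.
Unset Printing Implicit Defensive.

(** * Cut-free derivability as a predicate *)

Inductive cf : metaformula -> formula -> Prop :=
| cf_Ax A : cf [:: Fm A] A
| cf_OneR : cf [::] One
| cf_OverL D G B C E :
    cf G B -> cf (fill D [:: Fm C]) E -> cf (fill D (Fm (Over C B) :: G)) E
| cf_OverR G B C : cf (G ++ [:: Fm B]) C -> cf G (Over C B)
| cf_UnderL D G A C E :
    cf G A -> cf (fill D [:: Fm C]) E ->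
    cf (fill D (G ++ [:: Fm (Under A C)])) E
| cf_UnderR G A C : cf (Fm A :: G) C -> cf G (Under A C)
| cf_ProdL D A B E :
    cf (fill D [:: Fm A; Fm B]) E -> cf (fill D [:: Fm (Prod A B)]) E
| cf_ProdR G1 G2 A B : cf G1 A -> cf G2 B -> cf (G1 ++ G2) (Prod A B)
| cf_OneL D A : cf (fill D [::]) A -> cf (fill D [:: Fm One]) A
| cf_DiamL D A C :
    cf (fill D [:: Br [:: Fm A]]) C -> cf (fill D [:: Fm (Diam A)]) C
| cf_DiamR P A : cf P A -> cf [:: Br P] (Diam A)
| cf_BoxInvL D A C :
    cf (fill D [:: Fm A]) C -> cf (fill D [:: Br [:: Fm (BoxInv A)]]) C
| cf_BoxInvR P A : cf [:: Br P] A -> cf P (BoxInv A)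
| cf_BangL D A B : cf (fill D [:: Fm A]) B -> cf (fill D [:: Fm (Bang A)]) B
| cf_BangR As A : 0 < size As -> cf (bangs As) A -> cf (bangs As) (Bang A)
| cf_ContrB D As G B :
    0 < size As ->
    cf (fill D (bangs As ++ [:: Br (bangs As ++ G)])) B ->
    cf (fill D (bangs As ++ G)) B
| cf_Perm1 D A G B :
    cf (fill D (Fm (Bang A) :: G)) B -> cf (fill D (G ++ [:: Fm (Bang A)])) B
| cf_Perm2 D A G B :
    cf (fill D (G ++ [:: Fm (Bang A)])) B -> cf (fill D (Fm (Bang A) :: G)) B.

(** Only existence is claimed, so a predicate in [Prop] is enough; the cut argument can then work
    with [cf] and never handle [derivation] terms or [cut_free]. *)
Lemma cf_derivation P A : cf P A -> exists d : derivation P A, cut_free d.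
Proof.
elim=> {P A}.
- by move=> A; exists (Ax A).
- by exists OneR.
- move=> D G B C E _ [d1 h1] _ [d2 h2].
  by exists (OverL d1 d2); rewrite /= h1.
- by move=> G B C _ [d h]; exists (OverR d).
- move=> D G A C E _ [d1 h1] _ [d2 h2].
  by exists (UnderL d1 d2); rewrite /= h1.
- by move=> G A C _ [d h]; exists (UnderR d).
- by move=> D A B E _ [d h]; exists (ProdL d).
- move=> G1 G2 A B _ [d1 h1] _ [d2 h2].
  by exists (ProdR d1 d2); rewrite /= h1.
- by move=> D A _ [d h]; exists (OneL d).
- by move=> D A C _ [d h]; exists (DiamL d).
- by move=> P A _ [d h]; exists (DiamR d).
- by move=> D A C _ [d h]; exists (BoxInvL d).
- by move=> P A _ [d h]; exists (BoxInvR d).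
- by move=> D A B _ [d h]; exists (BangL d).
- by move=> As A n0 _ [d h]; exists (BangR n0 d).
- by move=> D As G B n0 _ [d h]; exists (ContrB n0 d).
- by move=> D A G B _ [d h]; exists (Perm1 d).
- by move=> D A G B _ [d h]; exists (Perm2 d).
Qed.

(** * Composition of contexts and block permutation *)

Fixpoint context_comp (D E : context) : context :=
  match D with
  | Hole L R =>
      match E with
      | Hole L1 R1 => Hole (L ++ L1) (R1 ++ R)
      | InBr L1 E' R1 => InBr (L ++ L1) E' (R1 ++ R)
      end
  | InBr L D' R => InBr L (context_comp D' E) R
  end.

Lemma fill_comp D E G : fill (context_comp D E) G = fill D (fill E G).
Proof.
elim: D => [L R|L D IH R] /=; last by rewrite IH.
by case: E => [L1 R1|L1 E R1] /=; rewrite -!catA.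
Qed.

Lemma fill_cat D L G R :
  fill D (L ++ G ++ R) = fill (context_comp D (Hole L R)) G.
Proof. by rewrite fill_comp. Qed.

(** Iterates [cf_Perm1]: each [!]-formula that has passed [G] becomes part of the block passed by
    the next. Needed because replacement can turn one permuted formula into a list. *)
Lemma cf_bangs_right D As G B :
  cf (fill D (bangs As ++ G)) B -> cf (fill D (G ++ bangs As)) B.
Proof.
elim: As G => [|A As IH] G /=; first by rewrite cats0.
move/cf_Perm1; rewrite -catA => /IH.
by rewrite -catA.
Qed.

Lemma cf_bangs_left D As G B :
  cf (fill D (G ++ bangs As)) B -> cf (fill D (bangs As ++ G)) B.
Proof.
elim: As G => [|A As IH] G /=; first by rewrite cats0.
rewrite -cat_rcons -cats1 => /IH.
by rewrite catA => /cf_Perm2.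
Qed.

(** * Simultaneous replacement of occurrences of a formula *)

Section Replacement.

Variables (A : formula) (P : metaformula).

(** A relation rather than a function: [repl_keep] also applies to [A], so any chosen set of
    occurrences, at any bracket depth, can be replaced. *)
Inductive repl : metaformula -> metaformula -> Prop :=
| repl_nil : repl [::] [::]
| repl_keep B G G' : repl G G' -> repl (Fm B :: G) (Fm B :: G')
| repl_br H H' G G' :
    repl H H' -> repl G G' -> repl (Br H :: G) (Br H' :: G')
| repl_here G G' : repl G G' -> repl (Fm A :: G) (P ++ G').

(** Items are nested through lists under [Br], hence the inner [fix] running over the content of a
    bracket. *)
Fixpoint repl_cons (x : item) G G' (h : repl G G') : repl (x :: G) (x :: G') :=
  match x with
  | Fm B => repl_keep B h
  | Br H =>
      repl_br ((fix refl (G0 : metaformula) : repl G0 G0 :=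
        match G0 with
        | [::] => repl_nil
        | y :: G1 => repl_cons y (refl G1)
        end) H) h
  end.

Lemma repl_refl G : repl G G.
Proof. by elim: G => [|x G IH]; [apply: repl_nil|apply: repl_cons]. Qed.

Lemma repl_cat G1 G1' G2 G2' :
  repl G1 G1' -> repl G2 G2' -> repl (G1 ++ G2) (G1' ++ G2').
Proof.
move=> h1 h2; elim: h1 => {G1 G1'} //=.
- by move=> B G G' _ IH; apply: repl_keep.
- by move=> H H' G G' h _ _ IH; apply: repl_br.
- by move=> G G' _ IH; rewrite -catA; apply: repl_here.
Qed.

Lemma repl_fill_here D : repl (fill D [:: Fm A]) (fill D P).
Proof.
elim: D => [L R|L D IH R] /=; apply: repl_cat; try exact: repl_refl.
- exact: repl_here (repl_refl R).
- exact: repl_br IH (repl_refl R).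
Qed.

Lemma repl_nilE X : repl [::] X -> X = [::].
Proof. by move=> h; inversion h. Qed.

Lemma repl_consFE B G X : repl (Fm B :: G) X ->
  exists Y G', [/\ X = Y ++ G', repl G G' &
                   Y = [:: Fm B] \/ B = A /\ Y = P].
Proof.
move=> h; inversion h as [|B' G0 G' h'| |G0 G' h']; subst.
- by exists [:: Fm B], G'; split=> //; left.
- by exists P, G'; split=> //; right.
Qed.

Lemma repl_consBE H G X : repl (Br H :: G) X ->
  exists H' G', [/\ X = Br H' :: G', repl H H' & repl G G'].
Proof.
by move=> h; inversion h as [| |H0 H' G0 G' h1 h2|]; subst; exists H', G'.
Qed.

Lemma repl1FE B X : repl [:: Fm B] X -> X = [:: Fm B] \/ B = A /\ X = P.
Proof. by move=> /repl_consFE[Y [G' [-> /repl_nilE ->]]]; rewrite cats0. Qed.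

Lemma repl1BE H X : repl [:: Br H] X -> exists2 H', X = [:: Br H'] & repl H H'.
Proof. by move=> /repl_consBE[H' [G' [-> h /repl_nilE ->]]]; exists H'. Qed.

Lemma repl_catE G1 G2 X : repl (G1 ++ G2) X ->
  exists X1 X2, [/\ X = X1 ++ X2, repl G1 X1 & repl G2 X2].
Proof.
elim: G1 X => [|[B|H] G1 IH] X /=.
- by move=> h; exists [::], X; split=> //; apply: repl_nil.
- move=> h; inversion h as [|B' G0 G' h'| |G0 G' h']; subst;
    have [X1 [X2 [-> h1 h2]]] := IH _ h'.
  + by exists (Fm B :: X1), X2; split=> //; apply: repl_keep.
  + by exists (P ++ X1), X2; split=> //; [rewrite catA|apply: repl_here].
- move=> /repl_consBE[H' [G' [-> h /IH[X1 [X2 [-> h1 h2]]]]]].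
  by exists (Br H' :: X1), X2; split=> //; apply: repl_br.
Qed.

(** The last clause carries the replacement made in the context over to the premise of a rule, which
    has the same context around another content. *)
Lemma repl_fillE D G X : repl (fill D G) X ->
  exists D' G', [/\ X = fill D' G', repl G G' &
    forall H H', repl H H' -> repl (fill D H) (fill D' H')].
Proof.
elim: D X => [L R|L D IH R] X /= /repl_catE[L' [X' [-> hL]]].
- move=> /repl_catE[G' [R' [-> hG hR]]].
  exists (Hole L' R'), G'; split=> // H H' hH.
  by do 2![apply: repl_cat => //].
- move=> /repl_consBE[Y [R' [-> /IH[D' [G' [-> hG hD]]] hR]]].
  exists (InBr L' D' R'), G'; split=> // H H' hH.
  by apply: repl_cat => //; apply: repl_br => //; apply: hD.
Qed.

Hypothesis P_bangs :
  forall B, A = Bang B -> exists2 As, 0 < size As & P = bangs As.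

Lemma repl_bangsE As X : repl (bangs As) X ->
  exists2 As', (0 < size As -> 0 < size As') & X = bangs As'.
Proof.
elim: As X => [|B As IH] X /=.
- by move=> /repl_nilE ->; exists [::].
- move=> /repl_consFE[Y [G' [-> /IH[As' _ ->] [->|[eA ->]]]]].
  + by exists (B :: As').
  + have [As0 n0 ->] := P_bangs (esym eA).
    exists (As0 ++ As'); last by rewrite /bangs map_cat.
    by rewrite size_cat ltn_addr.
Qed.

End Replacement.

(** * Replacement in the right premise *)

Definition cut_adm (A : formula) : Prop :=
  forall P D C, cf P A -> cf (fill D [:: Fm A]) C -> cf (fill D P) C.

Definition cut_adm_sub (A : formula) : Prop :=
  match A with
  | Var _ | One => True
  | Under B C | Over B C | Prod B C => cut_adm B /\ cut_adm C
  | Diam B | BoxInv B | Bang B => cut_adm B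
  end.

(** The premises of the right rule that introduces [A]. They are kept because every principal
    occurrence of [A] in the right premise uses them again. *)
Definition right_intro (P : metaformula) (A : formula) : Prop :=
  match A with
  | Var _ => False
  | One => P = [::]
  | Under B C => cf (Fm B :: P) C
  | Over C B => cf (P ++ [:: Fm B]) C
  | Prod B C => exists G1 G2, [/\ P = G1 ++ G2, cf G1 B & cf G2 C]
  | Diam B => exists2 Q, P = [:: Br Q] & cf Q B
  | BoxInv B => cf [:: Br P] B
  | Bang B => exists2 As, 0 < size As & P = bangs As /\ cf P B
  end.

Lemma right_intro_cf P A : right_intro P A -> cf P A.
Proof.
case: A => //= [-> |B C|B C|B C [G1 [G2 [-> h1 h2]]]|B [Q -> h]|B|B].
- exact: cf_OneR.
- exact: cf_UnderR.
- exact: cf_OverR.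
- exact: cf_ProdR.
- exact: cf_DiamR.
- exact: cf_BoxInvR.
- by move=> [As n0 [-> h]]; apply: cf_BangR.
Qed.

(** By induction on the derivation of [G]. A rule that does not act on a replaced occurrence is
    reapplied after replacement in its premises; one that does is traded for cuts between the
    replaced premises and those stored in [right_intro]. *)
Lemma cf_repl A P G G' C :
  cut_adm_sub A -> right_intro P A -> cf G C -> repl A P G G' -> cf G' C.
Proof.
move=> sub intro h; have PA := right_intro_cf intro.
have P_bangs B : A = Bang B -> exists2 As, 0 < size As & P = bangs As.
  by move=> eA; move: intro; rewrite eA => -[As n0 [-> _]]; exists As.
elim: h G' => {G C}.
- by move=> B G' /repl1FE[->|[-> ->]] //; apply: cf_Ax.
- by move=> G' /repl_nilE ->; apply: cf_OneR.
- move=> D G B C E _ IH1 _ IH2 G'.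
  move=> /repl_fillE[D' [X [-> /repl_consFE[Y [G0 [-> hG hY]]] hD]]].
  (* The active formula [C] is kept even if it equals [A]: in the conclusion it is only part of a
     compound formula, so it is not an occurrence to be replaced. *)
  have h1 := IH1 _ hG; have h2 := IH2 _ (hD _ _ (repl_refl _ _ _)).
  case: hY => [->|[eA ->]]; first exact: cf_OverL.
  move: sub intro; rewrite -eA => -[cutC cutB] /= h.
  (* Principal case: the cut on [C] puts [P] followed by [B] in the hole, and the cut on [B] then
     turns [B] into [G0]. *)
  have := cutC _ _ _ h h2.
  rewrite -[P ++ _]cats0 -catA fill_cat => /(cutB _ _ _ h1).
  by rewrite -fill_cat cats0.
- move=> G B C _ IH G' hG; apply: cf_OverR; apply: IH.
  by apply: repl_cat => //; apply: repl_refl.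
- move=> D G B C E _ IH1 _ IH2 G'.
  move=> /repl_fillE[D' [X [-> /repl_catE[G0 [Y [-> hG /repl1FE hY]]] hD]]].
  have h1 := IH1 _ hG; have h2 := IH2 _ (hD _ _ (repl_refl _ _ _)).
  case: hY => [->|[eA ->]]; first exact: cf_UnderL.
  move: sub intro; rewrite -eA => -[cutB cutC] /= h.
  have := cutC _ _ _ h h2.
  by rewrite -cat1s -[_ ++ P]cat0s fill_cat => /(cutB _ _ _ h1); rewrite -fill_cat.
- move=> G B C _ IH G' hG; apply: cf_UnderR; apply: IH.
  exact: repl_keep.
- move=> D B C E _ IH G' /repl_fillE[D' [X [-> /repl1FE hX hD]]].
  have h1 := IH _ (hD _ _ (repl_refl _ _ _)).
  case: hX => [->|[eA ->]]; first exact: cf_ProdL.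
  move: sub intro; rewrite -eA => -[cutB cutC] [G1 [G2 [-> hB hC]]].
  move: h1; rewrite -cat1s -[_ ++ _]cat0s fill_cat => /(cutB _ _ _ hB).
  rewrite -fill_cat cat0s -[G1 ++ _]cats0 -catA fill_cat => /(cutC _ _ _ hC).
  by rewrite -fill_cat cats0.
- move=> G1 G2 B C _ IH1 _ IH2 G' /repl_catE[X1 [X2 [-> h1 h2]]].
  by apply: cf_ProdR; [apply: IH1|apply: IH2].
- move=> D B _ IH G' /repl_fillE[D' [X [-> /repl1FE hX hD]]].
  have h1 := IH _ (hD _ _ (repl_nil _ _)).
  case: hX => [->|[eA ->]]; first exact: cf_OneL.
  by move: intro; rewrite -eA => /= ->.
- move=> D B C _ IH G' /repl_fillE[D' [X [-> /repl1FE hX hD]]].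
  have h1 := IH _ (hD _ _ (repl_refl _ _ _)).
  case: hX => [->|[eA ->]]; first exact: cf_DiamL.
  move: sub intro; rewrite -eA => cutB [Q -> hB].
  (* The premise of the left rule has [B] inside a bracket, so the cut takes place one level below
     the hole of [D']. *)
  have := cutB Q (context_comp D' (InBr [::] (Hole [::] [::]) [::])) C hB.
  by rewrite !fill_comp /= cats0; apply.
- by move=> Q B _ IH G' /repl1BE[Q' -> hQ]; apply: cf_DiamR; apply: IH.
- move=> D B C _ IH G' /repl_fillE[D' [X [-> /repl1BE[Y -> /repl1FE hY] hD]]].
  have h1 := IH _ (hD _ _ (repl_refl _ _ _)).
  case: hY => [->|[eA ->]]; first exact: cf_BoxInvL.
  by move: sub intro; rewrite -eA => cutB /= h; apply: cutB h h1.
- move=> Q B _ IH G' hQ; apply: cf_BoxInvR; apply: IH.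
  by apply: repl_br => //; apply: repl_nil.
- move=> D B C _ IH G' /repl_fillE[D' [X [-> /repl1FE hX hD]]].
  have h1 := IH _ (hD _ _ (repl_refl _ _ _)).
  case: hX => [->|[eA ->]]; first exact: cf_BangL.
  by move: sub intro; rewrite -eA => cutB [As _ [_ h]]; apply: cutB h h1.
- move=> As B n0 _ IH G' hG; have h := IH _ hG.
  have [As' n0' eG] := repl_bangsE P_bangs hG.
  by move: h; rewrite eG; apply: cf_BangR; apply: n0'.
- move=> D As G C n0 _ IH G' /repl_fillE[D' [X [-> + hD]]].
  move=> /repl_catE[Y [G0 [-> hY hG]]].
  have [As' n0' eY] := repl_bangsE P_bangs hY.
  rewrite eY; apply: cf_ContrB; first exact: n0'.
  (* The same replacement [hY] is made in both copies of the [!]-list, so they still match and can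
     be contracted. *)
  rewrite -eY; apply: IH; apply: hD; apply: repl_cat => //.
  by apply: repl_br (repl_nil _ _); apply: repl_cat.
- move=> D B G C _ IH G' /repl_fillE[D' [X [-> + hD]]].
  move=> /repl_catE[G0 [Y [-> hG hY]]].
  have h1 := IH _ (hD _ _ (repl_cat hY hG)).
  have [As _ eY] := @repl_bangsE _ _ P_bangs [:: B] _ hY.
  by move: h1; rewrite eY; apply: cf_bangs_right.
- move=> D B G C _ IH G' /repl_fillE[D' [X [-> + hD]]].
  rewrite -cat1s => /repl_catE[Y [G0 [-> hY hG]]].
  have h1 := IH _ (hD _ _ (repl_cat hG hY)).
  have [As _ eY] := @repl_bangsE _ _ P_bangs [:: B] _ hY.
  by move: h1; rewrite eY; apply: cf_bangs_left.
Qed.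

(** * Induction on the left premise and on the cut formula *)

(** A left rule ending the left premise acts in a context [E], and can be applied below the cut in
    the composite of [D] and [E]. A right rule yields [right_intro], and [cf_repl] is applied to the
    single occurrence in the hole of [D]. *)
Lemma cut_adm_step A : cut_adm_sub A -> cut_adm A.
Proof.
move=> sub P D C h; elim: h sub D C => {P A}.
- by [].
- move=> sub D C h; apply: cf_repl sub _ h (repl_fill_here _ _ D).
  by [].
- move=> E G B C F hB _ _ IH sub D C' h.
  by rewrite -fill_comp; apply: cf_OverL => //; rewrite fill_comp; apply: IH.
- move=> G B C hC _ sub D C' h.
  exact: cf_repl sub _ h (repl_fill_here _ _ D).
- move=> E G B C F hB _ _ IH sub D C' h.
  by rewrite -fill_comp; apply: cf_UnderL => //; rewrite fill_comp; apply: IH.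
- move=> G B C hC _ sub D C' h.
  exact: cf_repl sub _ h (repl_fill_here _ _ D).
- move=> E B C F _ IH sub D C' h.
  by rewrite -fill_comp; apply: cf_ProdL; rewrite fill_comp; apply: IH.
- move=> G1 G2 B C hB _ hC _ sub D C' h.
  apply: cf_repl sub _ h (repl_fill_here _ _ D).
  by exists G1, G2.
- move=> E B _ IH sub D C' h.
  by rewrite -fill_comp; apply: cf_OneL; rewrite fill_comp; apply: IH.
- move=> E B C _ IH sub D C' h.
  by rewrite -fill_comp; apply: cf_DiamL; rewrite fill_comp; apply: IH.
- move=> Q B hB _ sub D C' h.
  apply: cf_repl sub _ h (repl_fill_here _ _ D).
  by exists Q.
- move=> E B C _ IH sub D C' h.
  by rewrite -fill_comp; apply: cf_BoxInvL; rewrite fill_comp; apply: IH.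
- move=> Q B hB _ sub D C' h.
  exact: cf_repl sub _ h (repl_fill_here _ _ D).
- move=> E B C _ IH sub D C' h.
  by rewrite -fill_comp; apply: cf_BangL; rewrite fill_comp; apply: IH.
- move=> As B n0 hB _ sub D C' h.
  apply: cf_repl sub _ h (repl_fill_here _ _ D).
  by exists As.
- move=> E As G C n0 _ IH sub D C' h.
  by rewrite -fill_comp; apply: cf_ContrB => //; rewrite fill_comp; apply: IH.
- move=> E B G C _ IH sub D C' h.
  by rewrite -fill_comp; apply: cf_Perm1; rewrite fill_comp; apply: IH.
- move=> E B G C _ IH sub D C' h.
  by rewrite -fill_comp; apply: cf_Perm2; rewrite fill_comp; apply: IH.
Qed.

Lemma cf_cut A : cut_adm A.
Proof.
elim: A => [n||B IH1 C IH2|B IH1 C IH2|B IH1 C IH2|B IH|B IH|B IH];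
  exact: cut_adm_step.
Qed.

(** * Elimination of all cuts from a derivation *)

Lemma derivation_cf P A : derivation P A -> cf P A.
Proof.
elim=> {P A}.
- exact: cf_Ax.
- exact: cf_OneR.
- by move=> D G B C E _ h1 _; apply: cf_OverL.
- by move=> G B C _; apply: cf_OverR.
- by move=> D G A C E _ h1 _; apply: cf_UnderL.
- by move=> G A C _; apply: cf_UnderR.
- by move=> D A B E _; apply: cf_ProdL.
- by move=> G1 G2 A B _ h1 _; apply: cf_ProdR.
- by move=> D A _; apply: cf_OneL.
- by move=> D A C _; apply: cf_DiamL.
- by move=> P A _; apply: cf_DiamR.
- by move=> D A C _; apply: cf_BoxInvL.
- by move=> P A _; apply: cf_BoxInvR.
- by move=> D A B _; apply: cf_BangL.
- by move=> As A n0 _; apply: cf_BangR.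
- by move=> D As G B n0 _; apply: cf_ContrB.
- by move=> D A G B _; apply: cf_Perm1.
- by move=> D A G B _; apply: cf_Perm2.
- by move=> D P A C _ h1 _; apply: cf_cut.
Qed.

Theorem theorem1 (P : metaformula) (A : formula) (d : derivation P A) :
  exists d' : derivation P A, cut_free d'.
Proof. exact: cf_derivation (derivation_cf d). Qed.
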